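(* Let $\nu\ge 3$ be a square-free integer with $\nu\equiv 2$ or $3 \pmod 4$. Define $x_0=0$ and $x_{n+1}=\sqrt{x_n+\nu}$ for $n\ge0$. For $n\ge 0$ let $P_n\in\mathbb{Z}[t]$ be the minimal polynomial of $x_n$ over $\mathbb{Q}$ and $C_n$ its constant term. Let $p$ be a prime number which divides $C_n$ for some $n\ge1$, and let $n(p)$ be the least positive integer $n$ such that $p$ divides $C_n$. (1) If $p^2$ does not divide $C_{n(p)}$, then for every $n\ge1$ and every maximal ideal $\mathcal{P}$ of $\mathbb{Z}[x_n]$ with $\mathcal{P}\cap\mathbb{Z}=p\mathbb{Z}$, the localization $\mathbb{Z}[x_n]_{\mathcal{P}}$ is a discrete valuation ring. (2) If for every maximal ideal $\mathcal{P}$ of $\mathbb{Z}[x_{n(p)}]$ with $\mathcal{P}\cap\mathbb{Z}=p\mathbb{Z}$ the localization $\mathbb{Z}[x_{n(p)}]_{\mathcal{P}}$ is a discrete valuation ring, then $p^2$ does not divide $C_{n(p)}$.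
   Context: The square roots are the positive real ones. It is known that $P_n(t)=(t^2-\nu)^{\circ n}$ (the $n$-fold composition of $t^2-\nu$ with itself), so $P_0(t)=t$ and $C_0=0$. *)

(* Defs.v *)
From HB Require Import structures.
From mathcomp Require Import all_boot all_order all_algebra.
From mathcomp Require Import reals.
Set Implicit Arguments. Unset Strict Implicit. Unset Printing Implicit Defensive.
Import Order.TTheory GRing.Theory Num.Theory.
Local Open Scope ring_scope.

Fixpoint xseq (R : realType) (nu : R) (n : nat) : R :=
  match n with
  | 0 => 0
  | n'.+1 => Num.sqrt (xseq nu n' + nu)
  end.

Definition Zadj (R : realType) (a : R) : R -> Prop :=
  fun y => exists q : {poly int}, y = (map_poly intr q).[a].

Definition is_ideal (R : realType) (A I : R -> Prop) : Prop :=
  (forall y, I y -> A y) /\ I 0 /\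
  (forall y z, I y -> I z -> I (y - z)) /\
  (forall a y, A a -> I y -> I (a * y)).

Definition is_maximal_ideal (R : realType) (A I : R -> Prop) : Prop :=
  is_ideal A I /\ (exists a, A a /\ ~ I a) /\
  (forall J, is_ideal A J -> (forall y, I y -> J y) ->
     (forall y, J y <-> I y) \/ (forall y, A y -> J y)).

(* Localization A_I, realized inside the fraction field of A (a subfield of R). *)
Definition localization (R : realType) (A I : R -> Prop) : R -> Prop :=
  fun y => exists a b, A a /\ A b /\ ~ I b /\ y = a / b.

Definition frac_field (R : realType) (S : R -> Prop) : R -> Prop :=
  fun y => exists a b, S a /\ S b /\ b != 0 /\ y = a / b.

Definition is_dvr (R : realType) (S : R -> Prop) : Prop :=
  exists v : R -> int,
    (forall x y, frac_field S x -> frac_field S y -> x != 0 -> y != 0 ->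
       v (x * y) = v x + v y) /\
    (forall x y, frac_field S x -> frac_field S y -> x != 0 -> y != 0 ->
       x + y != 0 -> Num.min (v x) (v y) <= v (x + y)) /\
    (forall k : int, exists x, frac_field S x /\ x != 0 /\ v x = k) /\
    (forall x, S x <-> (x = 0 \/ (frac_field S x /\ x != 0 /\ 0 <= v x))).

(* Main.v *)
Require Import Defs.
From HB Require Import structures.
From mathcomp Require Import all_boot all_order all_algebra.
From mathcomp Require Import reals boolp.
From mathcomp Require Import zify ring.
Set Implicit Arguments. Unset Strict Implicit. Unset Printing Implicit Defensive.
Import Order.TTheory GRing.Theory Num.Theory.
Local Open Scope ring_scope.

(** With f = X^2 - nu, the iterate f^n is Eisenstein at 2 after a shift, so it is the
    minimal polynomial of x_n and C_n = f^n(0).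

    A maximal ideal M of Z[x_n] above p is (p, g(x_n)) for a monic g, and Dedekind's
    criterion says that Z[x_n] localized at M is a DVR unless f^n lies in (p, g)^2.  If it
    does, then the derivative 2^n f^0 f^1 ... f^(n-1) vanishes modulo M; for odd p some
    f^k(x_n) with k < n is in M, and f^n = f^k(X)^2 H(f^k(X)) + C_(n-k) puts C_(n-k) in
    (p, g)^2, so p^2 divides C_(n-k).  The congruence C_(m+np) = C_m modulo C_np^2 then
    brings this down to p^2 | C_np.  For p = 2, completing the square in
    f^n = (f^(n-1))^2 - nu contradicts nu = 2, 3 mod 4.

    Conversely, if p^2 | C_np then f^np = H X^2 + p^2 c lies in (p, X)^2, so at the maximal
    ideal (p, x_np) neither of p and x_np divides the other, which no valuation ring
    allows. *)

(** * Iterates of X^2 - c *)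

Fixpoint quad_iter (c : int) (n : nat) : {poly int} :=
  if n is n'.+1 then quad_iter c n' ^+ 2 - c%:P else 'X.

Lemma quad_iterD c m n : quad_iter c (m + n) = quad_iter c m \Po quad_iter c n.
Proof.
elim: m => [|m IH] /=; first by rewrite comp_polyX.
by rewrite IH comp_polyB comp_polyC expr2 comp_polyM -expr2.
Qed.

Lemma quad_iter_monic_size c n :
  quad_iter c n \is monic /\ size (quad_iter c n) = (2 ^ n).+1.
Proof.
elim: n => [|n [mon sz]] /=; first by rewrite monicX size_polyX.
have sz2 : size (quad_iter c n ^+ 2) = (2 ^ n.+1).+1.
  by rewrite polySpred ?monic_neq0 ?monic_exp // size_exp sz /= expnSr.
have lt : (size (- c%:P : {poly int}) < size (quad_iter c n ^+ 2)%R)%N.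
  by rewrite size_polyN sz2 (leq_ltn_trans (size_polyC_leq1 _)) // ltnS expn_gt0.
by rewrite size_polyDl // sz2 monicE lead_coefDl // -monicE monic_exp.
Qed.

(** Write the iterate as [q(X^2 - c)] with [q] the previous one. The factor [X + c] of [q - q(-c)]
    becomes [X^2] under the substitution, so no linear term survives. *)
Lemma quad_iterS_even c n :
  exists H, quad_iter c n.+1 = H * 'X^2 + ((quad_iter c n.+1)`_0)%:P.
Proof.
rewrite -addn1 quad_iterD /=; set q := quad_iter c n.
have /factor_theorem [r Er] : root (q - (q.[- c])%:P) (- c).
  by rewrite rootE !hornerE subrr.
have {}Er : q = r * ('X - (- c)%:P) + (q.[-c])%:P by rewrite -Er subrK.
pose s := 'X ^+ 2 - c%:P; rewrite -/s.
have Es : q \Po s = (r \Po s) * 'X^2 + (q.[-c])%:P.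
  by rewrite {1}Er comp_polyD comp_polyM comp_polyB comp_polyX !comp_polyC /s
     polyCN opprK subrK.
exists (r \Po s); rewrite {1}Es; congr (_ + _%:P).
by rewrite Es coefD coefMXn /= coefC add0r.
Qed.

(** Squaring is additive modulo 2, so only the leading monomial and the constant term remain. *)
Lemma quad_iter_mod2 c n :
  exists H, quad_iter c n = 'X^(2 ^ n) + ((quad_iter c n)`_0)%:P + 2%:P * H.
Proof.
elim: n => [|n [H E]].
  by exists 0; rewrite /= mulr0 addr0 coefX /= addr0 expr1.
have E0 : (quad_iter c n.+1)`_0 = (quad_iter c n)`_0 ^+ 2 - c.
  by rewrite /= coefB coefC /= expr2 coef0M -expr2.
rewrite E0 /=; set d := (quad_iter c n)`_0 in E *; rewrite E.
exists ('X^(2^n) * d%:P + 2%:P * H ^+ 2 + 2%:P * ('X^(2^n) + d%:P) * H).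
by rewrite expnSr exprM polyCB rmorphXn /=; ring.
Qed.

Lemma quad_iter_hornerS c n (a : int) :
  (quad_iter c n.+1).[a] = (quad_iter c n).[a] ^+ 2 - c.
Proof. by rewrite /= !hornerE. Qed.

(* An Eisenstein centre: the reduction of [quad_iter c n] mod 2 is [(X - a)^(2^n)]. *)
Lemma quad_iter_eisenstein_center (nu n : nat) :
  (nu %% 4 = 2 \/ nu %% 4 = 3)%N ->
  exists a : int, [/\ a = 0 \/ a = 1, exists k, (quad_iter nu n.+1).[0] + a = 2 * k &
    exists k, (quad_iter nu n.+1).[a] = 4 * k + 2].
Proof.
move=> [nu4|nu4].
  have [d Ed] : exists d, nu%:Z = 4 * d + 2 by exists (Posz (nu %/ 4)); lia.
  have [k Ek] : exists k, (quad_iter nu n.+1).[0] = 4 * k + 2.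
    elim: n => [|n [k Ek]].
      by rewrite quad_iter_hornerS /= hornerX Ed; exists (- d - 1); ring.
    by rewrite quad_iter_hornerS Ek Ed; exists (4 * k ^+ 2 + 4 * k - d); ring.
  exists 0; split; [by left | exists (2 * k + 1); rewrite Ek; ring | by exists k].
have [d Ed] : exists d, nu%:Z = 4 * d + 3 by exists (Posz (nu %/ 4)); lia.
(* For [nu = 3 mod 4] the residues modulo 4 of the values at 0 and 1 alternate between (1, 2) and
   (2, 1). The centre is whichever point has residue 2. *)
have [|] : ((exists k, (quad_iter nu n.+1).[0] = 4 * k + 1) /\
            (exists k, (quad_iter nu n.+1).[1] = 4 * k + 2)) \/
           ((exists k, (quad_iter nu n.+1).[0] = 4 * k + 2) /\
            (exists k, (quad_iter nu n.+1).[1] = 4 * k + 1)).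
- elim: n => [|n [[[k Ek] [l El]]|[[k Ek] [l El]]]].
  + left; rewrite !quad_iter_hornerS /= !hornerX Ed.
    by split; [exists (- d - 1) | exists (- d - 1)]; ring.
  + right; rewrite !(quad_iter_hornerS _ n.+1) Ek El Ed; split.
      by exists (4 * k ^+ 2 + 2 * k - d - 1); ring.
    by exists (4 * l ^+ 2 + 4 * l - d); ring.
  + left; rewrite !(quad_iter_hornerS _ n.+1) Ek El Ed; split.
      by exists (4 * k ^+ 2 + 4 * k - d); ring.
    by exists (4 * l ^+ 2 + 2 * l - d - 1); ring.
- case=> -[k Ek] [l El]; exists 1; split; [by right | | by exists l].
  by exists (2 * k + 1); rewrite Ek; ring.
- case=> -[k Ek] _; exists 0; split; [by left | | by exists k].
  by exists (2 * k + 1); rewrite Ek; ring.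
Qed.

(** * Irreducibility of the iterates over the rationals *)

Lemma irreducible_comp_XaddC (F : fieldType) (q : {poly F}) (a : F) :
  irreducible_poly (q \Po ('X + a%:P)) -> irreducible_poly q.
Proof.
have szX (r : {poly F}) : size (r \Po ('X + a%:P)) = size r.
  by rewrite size_comp_poly2 // size_XaddC.
move=> [sz irr]; rewrite szX in sz; split=> // r szr /dvdpP [s Es].
have dv : r \Po ('X + a%:P) %| q \Po ('X + a%:P).
  by rewrite Es comp_polyM dvdp_mull.
have := irr _ _ dv; rewrite szX => /(_ szr)/eqp_size; rewrite !szX => szrq.
by rewrite -dvdp_size_eqp ?szrq // Es dvdp_mull.
Qed.

(** Eisenstein at 2 after the shift [X + a]. The constant term becomes the value at [a], which is 2
    modulo 4. The other non-leading coefficients are even by [quad_iter_mod2], because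
    [(X + a)^(2^n)] is [X^(2^n) + a] modulo 2 when [a^2 = a]. *)
Lemma quad_iter_irreducible (nu n : nat) :
  (nu %% 4 = 2 \/ nu %% 4 = 3)%N ->
  irreducible_poly (map_poly intr (quad_iter nu n) : {poly rat}).
Proof.
move=> nu4; case: n => [|n].
  rewrite map_polyX; split; first by rewrite size_polyX.
  move=> q szq dv; have := dvdp_leq _ dv.
  rewrite polyX_eq0 size_polyX => /(_ isT) le2.
  rewrite -dvdp_size_eqp // size_polyX eqn_leq le2 /= ltn_neqAle eq_sym szq.
  by rewrite size_poly_gt0; apply: contraTneq dv => ->; rewrite dvd0p polyX_eq0.
have [a [a01 [k Ek] [l El]]] := quad_iter_eisenstein_center n nu4.
apply: (@irreducible_comp_XaddC _ _ a%:~R).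
rewrite -[X in _ \Po X](_ : map_poly intr ('X + a%:P) = _); last first.
  by rewrite rmorphD /= map_polyX map_polyC.
rewrite -map_comp_poly; apply/irreducible_rat_int.
have [mon sz] := quad_iter_monic_size nu n.+1.
set q := quad_iter nu n.+1 in Ek El mon sz *.
have szc : size (q \Po ('X + a%:P)) = (2 ^ n.+1).+1.
  by rewrite size_comp_poly2 ?size_XaddC.
apply: (@eisenstein_crit 2) => //.
- by rewrite szc eqSS -lt0n expn_gt0.
- rewrite lead_coef_comp ?size_XaddC // (monicP mon) mul1r.
  by rewrite lead_coefXaddC expr1n.
- rewrite -horner_coef0 horner_comp (_ : ('X + a%:P).[0] = a) ?El; first by clear; lia.
  by rewrite !hornerE.
move=> i; rewrite szc /= => lti.
have [H EH] := quad_iter_mod2 nu n.+1; rewrite -/q in EH; clearbody q.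
have [H' EH'] : exists H', ('X + a%:P) ^+ (2 ^ n.+1) =
    'X^(2 ^ n.+1) + a%:P + 2%:P * H' :> {poly int}.
  elim: {+}n.+1 => [|m [H' EH']]; first by exists 0; rewrite expr1; ring.
  exists (2%:P * H' ^+ 2 + 2%:P * ('X^(2 ^ m) + a%:P) * H' + 'X^(2^m) * a%:P).
  rewrite expnSr !exprM EH'.
  have Ea : a%:P = a%:P ^+ 2 :> {poly int} by case: a01 => ->; rewrite ?expr0n ?expr1n.
  by rewrite [X in _ = _ + X + _]Ea; ring.
rewrite EH comp_polyD comp_polyM comp_polyD !comp_polyC comp_Xn_poly EH'.
rewrite !(coefD, coefCM, coefXn, coefC) (ltn_eqF lti) add0r.
rewrite -horner_coef0; case: (i == 0)%N => /=; last first.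
  by rewrite !addr0 add0r rpredD // dvdz_mulr.
have -> (u v : int) : a + 2 * u + q.[0] + 2 * v = 2 * (k + u + v).
  by rewrite !mulrDr -Ek; ring.
by rewrite dvdz_mulr.
Qed.

(** Evaluate [H X^2 + C_(n+1)] at [C_m]: the missing linear term makes the congruence hold modulo
    the square of [C_m]. *)
Lemma quad_iter_const_rec c m n : exists h,
  (quad_iter c (n.+1 + m))`_0 = h * (quad_iter c m)`_0 ^+ 2 + (quad_iter c n.+1)`_0.
Proof.
have [H EH] := quad_iterS_even c n.
exists ((H \Po quad_iter c m).[0]).
rewrite -!horner_coef0 quad_iterD {1}EH.
by rewrite comp_polyD comp_polyM comp_Xn_poly comp_polyC -horner_coef0 !hornerE.
Qed.

(** Below [np] minimality excludes even [p]. Above [np], the constant term at [m] agrees with the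
    one at [m - np] modulo [C_np^2], hence modulo [p^2], and strong induction applies. *)
Lemma quad_iter_const_sqfree (c : int) (p np : nat) :
  (0 < np)%N -> (p%:Z %| (quad_iter c np)`_0)%Z ->
  (forall m, (0 < m < np)%N -> ~~ (p%:Z %| (quad_iter c m)`_0)%Z) ->
  ~~ ((p ^ 2)%:Z %| (quad_iter c np)`_0)%Z ->
  forall m, (0 < m)%N -> ~~ ((p ^ 2)%:Z %| (quad_iter c m)`_0)%Z.
Proof.
move=> np0 pnp minp p2np; elim/ltn_ind => m IH m0.
have p2p : (p%:Z %| (p ^ 2)%:Z)%Z by rewrite dvdzE dvdn_exp.
case: (ltngtP m np) => [ltm|gtm|-> //].
  by apply: contra (minp m _); [exact: dvdz_trans | rewrite m0].
have [h] := quad_iter_const_rec c np (m - np).-1.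
rewrite prednK ?subn_gt0 // subnK ?(ltnW gtm) // => ->.
rewrite rpredDl; first by apply: IH; lia.
have [d ->] := dvdzP pnp.
by rewrite exprMn mulrA dvdz_mull // -natz -natrX natz dvdzz.
Qed.

(** * Discrete valuation rings from a uniformizer *)

(** The quotient by [X] comes with the explicit bound [n], ready for inductions on a size bound. *)
Lemma poly_split_const (T : nzRingType) (H : {poly T}) n : (size H <= n.+1)%N ->
  H = \poly_(i < n) H`_i.+1 * 'X + (H`_0)%:P.
Proof.
move=> szH; apply/polyP=> i; rewrite coefD coefMX coefC coef_poly.
case: i => [|i] /=; rewrite ?add0r // addr0; case: ltnP => // le_ni.
by rewrite nth_default // (leq_trans szH).
Qed.

(** * Subrings of the reals and their maximal ideals *)

Record is_subring (R : realType) (A : R -> Prop) : Prop := {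
  subring_one : A 1;
  subring_sub : forall y z, A y -> A z -> A (y - z);
  subring_mul : forall y z, A y -> A z -> A (y * z) }.

Section Subring.
Variables (R : realType) (A : R -> Prop).
Hypothesis ringA : is_subring A.

Lemma subring1 : A 1. Proof. by case: ringA. Qed.

Lemma subringB y z : A y -> A z -> A (y - z).
Proof. by case: ringA => _ + _; apply. Qed.

Lemma subringM y z : A y -> A z -> A (y * z).
Proof. by case: ringA => _ _; apply. Qed.

Lemma subring0 : A 0.
Proof. by rewrite -(subrr 1); apply: subringB => //; apply: subring1. Qed.

Lemma subringD y z : A y -> A z -> A (y + z).
Proof.
move=> Ay Az; rewrite -[z]opprK -[- z]sub0r.
by do 2!apply: subringB => //; apply: subring0.
Qed.

Lemma subringX y n : A y -> A (y ^+ n).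
Proof.
move=> Ay; elim: n => [|n IH]; first exact: subring1.
by rewrite exprS; apply: subringM.
Qed.

Variable M : R -> Prop.
Hypothesis maxM : is_maximal_ideal A M.

Let idM : is_ideal A M. Proof. by case: maxM. Qed.

Lemma maxidealW y : M y -> A y. Proof. by case: idM => + _; apply. Qed.

Lemma maxideal0 : M 0. Proof. by case: idM => _ []. Qed.

Lemma maxidealB y z : M y -> M z -> M (y - z).
Proof. by case: idM => _ [_ [+ _]]; apply. Qed.

Lemma maxidealMr a y : A a -> M y -> M (a * y).
Proof. by case: idM => _ [_ [_]]; apply. Qed.

Lemma maxidealMl y a : M y -> A a -> M (y * a).
Proof. by move=> My Aa; rewrite mulrC; apply: maxidealMr. Qed.

Lemma maxidealD y z : M y -> M z -> M (y + z).
Proof.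
move=> My Mz; rewrite -[z]opprK -[- z]sub0r.
by do 2!apply: maxidealB => //; apply: maxideal0.
Qed.

Lemma maximal_ideal1 : ~ M 1.
Proof.
case: maxM => _ [[a [Aa nMa]] _] M1.
by apply: nMa; rewrite -[a]mulr1; apply: maxidealMr.
Qed.

(** If [a] is outside [M], the ideal [M + aA] contains 1, say [1 = m + a c], and then
    [b = b m + c (a b)] is in [M]. *)
Lemma maximal_prime a b : A a -> A b -> M (a * b) -> M a \/ M b.
Proof.
move=> Aa Ab Mab; case: maxM => _ [_ maxJ].
have [Ma|nMa] := EM (M a); [by left | right].
pose J y := exists m c, [/\ M m, A c & y = m + a * c].
have idJ : is_ideal A J.
  split; [|split; [|split]].
  - move=> _ [m [c [Mm Ac ->]]]; apply: subringD; first exact: maxidealW.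
    exact: subringM.
  - by exists 0, 0; split; [exact: maxideal0 | exact: subring0 | rewrite mulr0 addr0].
  - move=> _ _ [m [c [Mm Ac ->]]] [m' [c' [Mm' Ac' ->]]].
    exists (m - m'), (c - c'); split; [exact: maxidealB | exact: subringB | ring].
  - move=> d _ Ad [m [c [Mm Ac ->]]].
    exists (d * m), (d * c); split; [exact: maxidealMr | exact: subringM | ring].
have MJ y : M y -> J y.
  by move=> My; exists y, 0; split; [| exact: subring0 | rewrite mulr0 addr0].
case: (maxJ J idJ MJ) => [JM | /(_ 1 subring1) [m [c [Mm Ac E]]]].
  case: nMa; apply/JM; exists 0, 1.
  by split; [exact: maxideal0 | exact: subring1 | rewrite mulr1 add0r].
have -> : b = b * m + c * (a * b) by rewrite -[LHS]mulr1 E; ring.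
by apply: maxidealD; apply: maxidealMr.
Qed.

Lemma maximal_primeN a b : A a -> A b -> ~ M a -> ~ M b -> ~ M (a * b).
Proof. by move=> Aa Ab nMa nMb /(maximal_prime Aa Ab) []. Qed.

Lemma maximal_primeXN a n : A a -> ~ M a -> ~ M (a ^+ n).
Proof.
move=> Aa nMa; elim: n => [|n IH]; first exact: maximal_ideal1.
by rewrite exprS; apply: maximal_primeN => //; apply: subringX.
Qed.

Lemma notin_ideal_neq0 a : ~ M a -> a != 0.
Proof. by move=> nMa; apply: contra_notN nMa => /eqP ->; apply: maxideal0. Qed.

(** The hypothesis says, with denominators cleared, that every nonzero element of [A] is a power of
    [pi] times a unit of the localization. The exponent is the valuation. *)
Lemma dvr_of_uniformizer (pi : R) :
    M pi -> pi != 0 ->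
    (forall a, A a -> a != 0 -> exists k s c,
       [/\ A s, ~ M s, A c, ~ M c & a * s = pi ^+ k * c]) ->
  is_dvr (localization A M).
Proof.
move=> Mpi pi0 fact; have Api := maxidealW Mpi.
pose S := localization A M.
pose spec y (k : int) := exists a b,
  [/\ A a, ~ M a, A b, ~ M b & y = pi ^ k * (a / b)].
have nz := notin_ideal_neq0.
have AS a : A a -> S a.
  move=> Aa; exists a, 1; split=> //; split; first exact: subring1.
  by split; [exact: maximal_ideal1 | rewrite divr1].
have specS y : S y -> y != 0 -> exists k : nat, spec y k.
  move=> [a [b [Aa [Ab [nMb ->]]]]] ab0.
  have a0 : a != 0 by apply: contraNneq ab0 => ->; rewrite mul0r.
  have [k [s [c [As nMs Ac nMc E]]]] := fact a Aa a0.
  exists k, c, (s * b); split=> //; first exact: subringM.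
    exact: maximal_primeN.
  have := nz _ nMs; have := nz _ nMb => b0 s0.
  have -> : a = pi ^+ k * c / s by rewrite -E mulfK.
  by rewrite -exprnP; field; rewrite b0 s0.
have specF y : frac_field S y -> y != 0 -> exists k, spec y k.
  move=> [a [b [Sa [Sb [b0 ->]]]]] ab0.
  have a0 : a != 0 by apply: contraNneq ab0 => ->; rewrite mul0r.
  have [k [u [t [Au nMu At nMt Ea]]]] := specS a Sa a0.
  have [l [u' [t' [Au' nMu' At' nMt' Eb]]]] := specS b Sb b0.
  exists (k%:Z - l%:Z), (u * t'), (t * u').
  split; try exact: subringM; try exact: maximal_primeN.
  have {}nz := (nz _ nMu, nz _ nMt, nz _ nMu', nz _ nMt').
  rewrite Ea Eb expfzDr // -invr_expz.
  by field; rewrite !nz expfz_neq0.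
have Fspec y k : spec y k -> frac_field S y /\ y != 0.
  move=> [a [b [Aa nMa Ab nMb ->]]]; split; last first.
    rewrite mulf_neq0 ?expfz_neq0 // mulf_neq0 ?invr_eq0 //; exact: nz.
  case: k => k.
    exists (pi ^+ k * a), b; split; first by apply: AS; apply: subringM => //; apply: subringX.
    by split; [exact: AS | split; [exact: nz | rewrite mulrA]].
  exists a, (pi ^+ k.+1 * b); split; first exact: AS.
  split; first by apply: AS; apply: subringM => //; apply: subringX.
  split; first by rewrite mulf_neq0 ?expf_neq0 //; exact: nz.
  by rewrite NegzE -invr_expz -exprnP invfM mulrCA.
(* If [l < k], equating the two forms of [y] puts a product of elements outside [M] equal to a
   multiple of [pi], against primality. *)
have le_spec y k l : spec y k -> spec y l -> k <= l.
  move=> [a [b [Aa nMa Ab nMb ->]]] [a' [b' [Aa' nMa' Ab' nMb' E]]].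
  rewrite leNgt; apply/negP => ltkl.
  have [m Em] : exists m : nat, k = l + m.+1%:Z.
    by exists (absz (k - l - 1)%R); move: ltkl; clear; lia.
  have : pi ^+ m.+1 * (a * b') = a' * b.
    have b0 := nz _ nMb; have b'0 := nz _ nMb'.
    move: E; rewrite Em expfzDr // -mulrA => /(mulfI (expfz_neq0 _ pi0)).
    rewrite -exprnP => /(congr1 ( *%R^~ (b * b'))) E.
    transitivity (pi ^+ m.+1 * (a / b) * (b * b')); first by field; rewrite b0.
    by rewrite E; field; rewrite b'0.
  move=> E'; have : ~ M (a' * b) by apply: maximal_primeN.
  apply; rewrite -E' exprS -mulrA; apply: maxidealMl => //.
  by apply: subringM; [exact: subringX | exact: subringM].
have uniq_spec y k l : spec y k -> spec y l -> k = l.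
  by move=> yk yl; apply/le_anti; rewrite (le_spec y k l) ?(le_spec y l k).
(* The default 0 is used at zero and outside the fraction field, where the valuation axioms ask
   nothing. *)
have /boolp.choice [v Hv] y : exists k, frac_field S y -> y != 0 -> spec y k.
  have [[Fy y0]|nFy] := EM (frac_field S y /\ y != 0).
    by have [k yk] := specF y Fy y0; exists k.
  by exists 0 => Fy y0; case: nFy.
have vE y k : spec y k -> v y = k.
  by move=> yk; have [Fy y0] := Fspec y k yk; apply: uniq_spec yk; apply: Hv.
have Sspec y (k : nat) : spec y k -> S y.
  move=> [a [b [Aa nMa Ab nMb ->]]]; exists (pi ^+ k * a), b.
  split; first by apply: subringM => //; apply: subringX.
  by rewrite mulrA.
exists v; split; [|split; [|split]].
- move=> y z Fy Fz y0 z0; apply: vE.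
  have [a [b [Aa nMa Ab nMb Ey]]] := Hv y Fy y0.
  have [a' [b' [Aa' nMa' Ab' nMb' Ez]]] := Hv z Fz z0.
  exists (a * a'), (b * b'); split; try exact: subringM; try exact: maximal_primeN.
  rewrite {1}Ey {1}Ez expfzDr //.
  by have := nz _ nMb; have := nz _ nMb' => b'0 b0; field; rewrite b0 b'0.
- move=> y z Fy Fz y0 z0 yz0.
  wlog le_yz : y z Fy Fz y0 z0 yz0 / v y <= v z.
    move=> W; case: (leP (v y) (v z)) => [le|/ltW le].
      by have := W y z Fy Fz y0 z0 yz0 le; rewrite min_l.
    by have := W z y Fz Fy z0 y0; rewrite (addrC z) min_l // => /(_ yz0 le).
  rewrite min_l //.
  have [a [b [Aa nMa Ab nMb Ey]]] := Hv y Fy y0.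
  have [a' [b' [Aa' nMa' Ab' nMb' Ez]]] := Hv z Fz z0.
  have [m Em] : exists m : nat, v z = v y + m%:Z.
    by exists (absz (v z - v y)%R); move: le_yz; clear; lia.
  (* [w] is the sum divided by [pi ^ (v y)]; it lies in the localization, so its exponent is a
     natural number. *)
  pose w := (a * b' + pi ^+ m * a' * b) / (b * b').
  have b0 := nz _ nMb; have b'0 := nz _ nMb'.
  have Eyz : y + z = pi ^ (v y) * w.
    by rewrite {1}Ey {1}Ez Em expfzDr // -exprnP /w; field; rewrite b0 b'0.
  have w0 : w != 0 by apply: contraNneq yz0 => w0; rewrite Eyz w0 mulr0.
  have Sw : S w.
    exists (a * b' + pi ^+ m * a' * b), (b * b').
    split; first by apply: subringD; do ?apply: subringM => //; apply: subringX.
    by split; [exact: subringM | split; [exact: maximal_primeN | ]].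
  have [k [c [d [Ac nMc Ad nMd Ew]]]] := specS w Sw w0.
  rewrite (vE (y + z) (v y + k%:Z)) ?lerDl //.
  by exists c, d; split=> //; rewrite Eyz Ew expfzDr // mulrA.
- move=> k; exists (pi ^ k).
  have sk : spec (pi ^ k) k.
    exists 1, 1; rewrite divr1 mulr1.
    by split=> //; try exact: subring1; exact: maximal_ideal1.
  by have [Fk k0] := Fspec _ _ sk; rewrite (vE _ _ sk).
- move=> y; split=> [Sy|].
    have [->|y0] := eqVneq y 0; [by left | right].
    have [k yk] := specS y Sy y0.
    by have [Fy _] := Fspec _ _ yk; rewrite (vE _ _ yk).
  case=> [->|[Fy [y0]]]; first exact/AS/subring0.
  by have := Hv y Fy y0; case: (v y) => // k /Sspec.
Qed.

(* The powers of [pi] dividing [a] are bounded: [a] divides a nonzero integer,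
   hence (locally) a power of [p], while a power of [pi] is divisible by [p]. *)
Lemma dvr_of_principal (p : nat) (pi : R) :
    prime p -> (forall m : int, M m%:~R <-> (p%:Z %| m)%Z) ->
    (forall y, A y -> exists2 G : {poly int}, G \is monic & root (map_poly intr G) y) ->
    M pi ->
    (forall y, M y -> exists s c, [/\ A s, ~ M s, A c & y * s = pi * c]) ->
  is_dvr (localization A M).
Proof.
move=> pr_p Mp intA Mpi prin; have Api := maxidealW Mpi.
have p0 : p%:R != 0 :> R by rewrite pnatr_eq0 -lt0n prime_gt0.
have Az (m : int) : A m%:~R.
  have An (n : nat) : A n%:R.
    elim: n => [|n IH]; first exact: subring0.
    by rewrite -natr1; apply: subringD => //; apply: subring1.
  case: m => n; first exact: An.
  rewrite NegzE mulrNz -sub0r; apply: subringB; [exact: subring0 | exact: An].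
have Aev (G : {poly int}) y : A y -> A (map_poly intr G).[y].
  move=> Ay; elim/poly_ind: G => [|G c IH].
    by rewrite map_poly0 horner0; apply: subring0.
  rewrite rmorphD rmorphM /= map_polyX map_polyC /= !hornerE.
  by apply: subringD => //; apply: subringM.
have MpR : M p%:R by apply/(Mp p%:Z); rewrite dvdzz.
have pi0 : pi != 0.
  have [s [c [As nMs Ac E]]] := prin _ MpR.
  apply: contraNneq (mulf_neq0 p0 (notin_ideal_neq0 nMs)) => pi0.
  by rewrite E pi0 mul0r.
have [m [w [d [Aw nMw Ad Ewd]]]] : exists m w d,
    [/\ A w, ~ M w, A d & pi ^+ m * w = p%:R * d].
  have [G monG rG] := intA _ Api.
  (* Start from a monic [G] killing [pi]. A constant term divisible by [p] is removed and one factor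
     [pi] moved into the power. Once the constant term is prime to [p], the value of [H] at [pi] is
     outside [M] and serves as [w]. *)
  suff main n (H : {poly int}) j : (size H <= n)%N ->
      ~~ (H \is a polyOver (dvdz p)) ->
      (exists2 d, A d & pi ^+ j * (map_poly intr H).[pi] = p%:R * d) ->
    exists m w d, [/\ A w, ~ M w, A d & pi ^+ m * w = p%:R * d].
    apply: (main _ G 0%N (leqnn _)).
      apply/polyOverP => /(_ (size G).-1); rewrite -lead_coefE (monicP monG).
      by rewrite dvdz1 => /eqP p1; move: pr_p; rewrite (_ : p = 1%N).
    by exists 0; [exact: subring0 | rewrite mulr0 mul1r; apply/eqP].
  elim: n H j => [|n IH] H j.
    by rewrite leqn0 size_poly_eq0 => /eqP ->; rewrite rpred0.
  move=> szH nH [d Ad Ed].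
  pose H1 := \poly_(i < n) H`_i.+1.
  have EH : H = H1 * 'X + (H`_0)%:P.
    exact: poly_split_const.
  have E1 : (map_poly intr H).[pi] = (map_poly intr H1).[pi] * pi + (H`_0)%:~R.
    by rewrite {1}EH rmorphD rmorphM /= map_polyX map_polyC /= !hornerE.
  have [pH0|npH] := boolP (p%:Z %| H`_0)%Z; last first.
    exists j, (map_poly intr H).[pi], d; split=> //; first exact: Aev.
    rewrite E1 => Mr; case/negP: npH; apply/Mp.
    rewrite -[_%:~R](addKr ((map_poly intr H1).[pi] * pi)) addrC.
    by apply: maxidealB => //; apply: maxidealMr => //; apply: Aev.
  have [h Eh] := dvdzP pH0.
  apply: (IH H1 j.+1); first exact: size_poly.
    apply: contra nH => pH1; rewrite EH rpredD ?polyOverC //.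
    by apply/polyOverP=> -[|i]; rewrite coefMX //=; apply: (polyOverP pH1).
  exists (d - pi ^+ j * h%:~R).
    by apply: subringB => //; apply: subringM => //; apply: subringX.
  rewrite mulrBr -Ed E1 Eh rmorphM /= exprSr.
  by rewrite -[p%:~R]/(p%:R : R); ring.
(* Cancel powers of [X] from a monic polynomial killing [a] until the constant term is nonzero; that
   term, up to sign, is the multiple [N]. *)
have divN a : A a -> a != 0 -> exists (N : int) b, [/\ N != 0, A b & a * b = N%:~R].
  move=> Aa a0; have [G monG rG] := intA _ Aa.
  suff main n (H : {poly int}) : (size H <= n)%N -> H != 0 ->
      root (map_poly intr H) a ->
    exists (N : int) b, [/\ N != 0, A b & a * b = N%:~R].
    exact: (main _ G (leqnn _) (monic_neq0 monG)).
  elim: n H => [|n IH] H.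
    by rewrite leqn0 size_poly_eq0 => /eqP ->; rewrite eqxx.
  move=> szH H0 /eqP rH.
  pose H1 := \poly_(i < n) H`_i.+1.
  have EH : H = H1 * 'X + (H`_0)%:P by exact: poly_split_const.
  have E1 : (map_poly intr H1).[a] * a + (H`_0)%:~R = 0.
    by rewrite -rH {2}EH rmorphD rmorphM /= map_polyX map_polyC /= !hornerE.
  have [h0|h0] := eqVneq H`_0 0.
    apply: (IH H1); first exact: size_poly.
      by apply: contraNneq H0 => H10; rewrite EH H10 h0 mul0r add0r.
    move: E1; rewrite h0 addr0 => /eqP; rewrite mulf_eq0 (negPf a0) orbF.
    by rewrite rootE.
  exists (- H`_0), (map_poly intr H1).[a]; split; rewrite ?oppr_eq0 //.
    exact: Aev.
  by rewrite mulrC rmorphN /=; apply/eqP; rewrite -addr_eq0; apply/eqP.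
apply: (dvr_of_uniformizer Mpi pi0) => a Aa a0.
have [//|nfact] := EM (exists k s c, [/\ A s, ~ M s, A c, ~ M c & a * s = pi ^+ k * c]).
(* Without a factorization the cofactor [c] always stays in [M], so another [pi] can be
   extracted. *)
have desc k : exists s c, [/\ A s, ~ M s, A c & a * s = pi ^+ k * c].
  elim: k => [|k [s [c [As nMs Ac E]]]].
    exists 1, a; split=> //; [exact: subring1 | exact: maximal_ideal1 |].
    by rewrite mulr1 mul1r.
  have [Mc|nMc] := EM (M c); last by case: nfact; exists k, s, c.
  have [t [e [At nMt Ae Ee]]] := prin c Mc.
  exists (s * t), e; split=> //; [exact: subringM | exact: maximal_primeN |].
  by rewrite mulrA E -mulrA Ee exprSr mulrA.
have [N [b [N0 Ab EN]]] := divN a Aa a0.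
have [j [N' [nN' EN']]] : exists j (N' : int), ~ M N'%:~R /\ N = p%:Z ^+ j * N'.
  have n0 : (0 < absz N)%N by rewrite absz_gt0.
  have [m' cop Em'] := pfactor_coprime pr_p n0.
  exists (logn p (absz N)), ((-1) ^+ (N < 0)%R * m'%:Z); split.
    by move/Mp; rewrite dvdzE abszMsign /= => pm'; move: cop; rewrite prime_coprime // pm'.
  have EN' : (absz N)%:Z = m'%:Z * p%:Z ^+ logn p (absz N).
    by rewrite {1}Em' PoszM -!natz natrX.
  by rewrite {1}[N]intEsign EN'; ring.
(* Multiplied by [w ^+ j], the power [pi ^+ (m * j)] supplies [p ^+ j], which cancels the [p]-part
   of [N]. The one remaining [pi] puts [N' * s * w ^+ j] in [M]. *)
have [s [c [As nMs Ac E]]] := desc (m * j).+1.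
have : N'%:~R * s * w ^+ j = pi * (d ^+ j * c * b).
  have pj0 : p%:R ^+ j != 0 :> R by rewrite expf_neq0.
  apply: (mulfI pj0).
  have -> : p%:R ^+ j * (N'%:~R * s * w ^+ j) = a * b * s * w ^+ j.
    rewrite EN EN' rmorphM rmorphXn /=; by rewrite -[p%:~R]/(p%:R : R); ring.
  transitivity (pi * (pi ^+ m * w) ^+ j * c * b); last by rewrite Ewd exprMn; ring.
  by rewrite (mulrAC a) E exprS exprM exprMn; ring.
move=> E'; have : ~ M (N'%:~R * s * w ^+ j).
  apply: maximal_primeN; [exact: subringM | exact: subringX | |].
    exact: maximal_primeN.
  exact: maximal_primeXN.
case; rewrite E'; apply: maxidealMl => //.
by do 2!apply: subringM => //; apply: subringX.
Qed.
End Subring.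

(** * Evaluation of integer polynomials *)

(** Named so that it can carry a ring morphism structure; it unfolds to the expression in [Zadj]. *)
Definition evz (R : realType) (x : R) (q : {poly int}) : R := (map_poly intr q).[x].

HB.instance Definition _ (R : realType) (x : R) :=
  GRing.RMorphism.copy (evz x) (horner_eval x \o map_poly intr).

Lemma evzC (R : realType) (x : R) (c : int) : evz x c%:P = c%:~R.
Proof. by rewrite /evz map_polyC hornerC. Qed.

Lemma evzX (R : realType) (x : R) : evz x 'X = x.
Proof. by rewrite /evz map_polyX hornerX. Qed.

Lemma Zadj_evz (R : realType) (x : R) q : Zadj x (evz x q).
Proof. by exists q. Qed.

Lemma Zadj_subring (R : realType) (x : R) : is_subring (Zadj x).
Proof.
split=> [|_ _ [q ->] [r ->]|_ _ [q ->] [r ->]].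
- by exists 1; rewrite rmorph1 hornerC.
- by exists (q - r); rewrite -!/(evz x _) rmorphB.
- by exists (q * r); rewrite -!/(evz x _) rmorphM.
Qed.

Lemma Zadj_integral (R : realType) (x : R) (F : {poly int}) :
  F \is monic -> evz x F = 0 -> forall y, Zadj x y ->
  exists2 G : {poly int}, G \is monic & root (map_poly intr G) y.
Proof.
move=> monF Fx _ [q ->].
have intC (H : {poly int}) :
    {in map_poly intr H : seq R, integralRange (intr : int -> R)}.
  by apply/integral_poly => i; rewrite coef_map; apply: integral_id.
apply: (@integral_horner_root _ _ (intr : {rmorphism int -> R}) x (map_poly intr F)) => //.
  exact: monic_map.
exact/eqP.
Qed.

(** * The nested radicals and their minimal polynomials *)

Lemma xseq_ge0 (R : realType) (nu : R) n : 0 <= xseq nu n.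
Proof. by case: n => //= n; apply: sqrtr_ge0. Qed.

(** Each application of [X^2 - nu] undoes one square root. At [n = 0] this makes the [m]-th radical
    a root of the [m]-th iterate. *)
Lemma quad_iter_xseq (R : realType) (nu m n : nat) :
  evz (xseq (nu%:R : R) (m + n)) (quad_iter nu m) = xseq nu%:R n.
Proof.
elim: m n => [|m IH] n; first by rewrite evzX.
rewrite addSnnS /= rmorphB rmorphXn /= evzC IH /= sqr_sqrtr ?addrK //.
by rewrite addr_ge0 ?xseq_ge0.
Qed.

(** The rational gcd of [F] and [q] vanishes at [x], so it is not constant and is associate to [F].
    The quotient is integral because [F] is monic. *)
Lemma minpoly_dvd (R : realType) (x : R) (F q : {poly int}) :
  F \is monic -> irreducible_poly (map_poly intr F : {poly rat}) ->
  evz x F = 0 -> evz x q = 0 -> exists h, q = F * h.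
Proof.
move=> monF [sF irF] Fx qx.
suff dv : F %| q.
  by have [h ->] := dvdpP_int dv; exists h; rewrite zprimitive_monic.
rewrite -dvdp_rat_int; set Fq := map_poly _ F in sF irF *; set qq := map_poly _ q.
have ratrE (r : {poly int}) : map_poly ratr (map_poly intr r : {poly rat}) =
    map_poly intr r :> {poly R}.
  by rewrite -map_poly_comp; apply: eq_map_poly => c /=; rewrite ratr_int.
have rg : root (map_poly ratr (gcdp Fq qq)) x.
  by rewrite gcdp_map root_gcd !ratrE; apply/andP; split; apply/eqP.
have := irF (gcdp Fq qq) _ (dvdp_gcdl _ _).
case: eqP => [/eqP/size_poly1P [c c0 Ec]|_ /(_ isT) Eg].
  by move: rg; rewrite Ec map_polyC rootC fmorph_eq0 (negPf c0).
by rewrite -(eqp_dvdl _ Eg) dvdp_gcdr.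
Qed.

Lemma minpoly_unique (R : realType) (x : R) (F G : {poly int}) :
  F \is monic -> irreducible_poly (map_poly intr F : {poly rat}) -> evz x F = 0 ->
  G \is monic -> irreducible_poly (map_poly intr G : {poly rat}) -> evz x G = 0 ->
  F = G.
Proof.
move=> monF irF Fx monG irG Gx.
have [h Eh] := minpoly_dvd monF irF Fx Gx.
have [h' Eh'] := minpoly_dvd monG irG Gx Fx.
apply: (map_inj_poly (intr_inj : injective (intr : int -> rat))) => //.
apply/eqP; rewrite -eqp_monic ?monic_map //; apply/andP; split.
  by rewrite Eh rmorphM dvdp_mulr.
by rewrite Eh' rmorphM dvdp_mulr.
Qed.

(** * Dedekind's criterion *)

(** The square of the ideal [(p, g)] of Z[X], through its generators. *)
Definition in_ideal_square (p : int) (g q : {poly int}) :=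
  exists a b d, q = g ^+ 2 * a + p%:P * g * b + p%:P ^+ 2 * d.

Lemma in_ideal_squareD p g q r :
  in_ideal_square p g q -> in_ideal_square p g r -> in_ideal_square p g (q + r).
Proof.
move=> [a [b [d ->]]] [a' [b' [d' ->]]].
by exists (a + a'), (b + b'), (d + d'); ring.
Qed.

Lemma in_ideal_squareM p g u s r s' r' :
  in_ideal_square p g (u * (g * s + p%:P * r) * (g * s' + p%:P * r')).
Proof. by exists (u * s * s'), (u * (s * r' + r * s')), (u * r * r'); ring. Qed.

Section OverPrime.
Variables (R : realType) (x : R) (F : {poly int}) (p : nat) (M : R -> Prop).
Hypothesis monF : F \is monic.
Hypothesis Fx : evz x F = 0.
Hypothesis pr_p : prime p.
Hypothesis maxM : is_maximal_ideal (Zadj x) M.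
Hypothesis Mp : forall m : int, M m%:~R <-> (p%:Z %| m)%Z.

Let MD := maxidealD maxM.
Let MB := maxidealB maxM.
Let Mev (q r : {poly int}) : M (evz x r) -> M (evz x (q * r)).
Proof. by move=> Mr; rewrite rmorphM /=; apply: (maxidealMr maxM) => //; apply: Zadj_evz. Qed.

Lemma ideal_evzp (r : {poly int}) : M (evz x ((p%:Z)%:P * r)).
Proof. by rewrite mulrC; apply: Mev; rewrite evzC; apply/Mp/dvdzz. Qed.

(** Take [g] of least degree among the monic polynomials whose value lies in [M]; [F] is one of
    them. Every remainder modulo [g] with value in [M] is then divisible by [p]. *)
Lemma maximal_ideal_generators : exists g : {poly int},
  [/\ g \is monic, M (evz x g) &
    forall q, M (evz x q) -> exists s r, q = g * s + (p%:Z)%:P * r].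
Proof.
pose Q n := `[< exists2 g : {poly int}, g \is monic & M (evz x g) /\ size g = n >].
have exQ : exists n, Q n.
  by exists (size F); apply/asboolP; exists F => //;
     rewrite Fx; split=> //; case: maxM => -[_ []].
case: (ex_minnP exQ) => n /asboolP [g mong [Mg szg]] min_n.
exists g; split=> // q Mq.
have /polyOver_dvdzP [r Er] : Pdiv.Ring.rmodp q g \is a polyOver (dvdz p).
  have : M (evz x (Pdiv.Ring.rmodp q g)).
    have E := Pdiv.RingMonic.rdivp_eq mong q.
    by rewrite -[Pdiv.Ring.rmodp q g](addKr (Pdiv.Ring.rdivp q g * g)) -E addrC rmorphB;
       apply: MB => //; apply: Mev.
  have : (size (Pdiv.Ring.rmodp q g) < n)%N.
    by rewrite -szg Pdiv.Ring.ltn_rmodp monic_neq0.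
  move: (Pdiv.Ring.rmodp q g) => r.
  move: {2}(size r) (leqnn (size r)) => k.
  elim: k r => [|k IH] r; first by rewrite leqn0 size_poly_eq0 => /eqP -> _ _; apply: rpred0.
  move=> szr ltr Mr.
  have [lek|ltk] := leqP (size r) k; first exact: IH.
  have Ek : size r = k.+1 by apply/eqP; rewrite eqn_leq szr.
  have Elc : lead_coef r = r`_k by rewrite lead_coefE Ek.
  pose r1 := r - (r`_k)%:P * 'X^k.
  have szr1 : (size r1 <= k)%N.
    apply/leq_sizeP => j; rewrite leq_eqVlt => /orP [/eqP <-|ltkj].
      by rewrite coefB coefCM coefXn eqxx mulr1 subrr.
    by rewrite coefB coefCM coefXn (gtn_eqF ltkj) mulr0 subr0 nth_default // Ek.
  have Er : r = r1 + (r`_k)%:P * 'X^k by rewrite subrK.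
  have [/dvdzP [c Ec]|ndv] := boolP (p%:Z %| r`_k)%Z.
    have Ec' : (r`_k)%:P * 'X^k = (p%:Z)%:P * (c%:P * 'X^k) by rewrite Ec polyCM; ring.
    have pr1 : r1 \is a polyOver (dvdz p).
      apply: IH => //; first by rewrite (leq_ltn_trans szr1) // ltnW // -Ek.
      by rewrite rmorphB; apply: MB => //; rewrite Ec'; apply: ideal_evzp.
    rewrite Er rpredD // Ec'; apply/polyOver_dvdzP; exists (c%:P * 'X^k).
    by rewrite mul_polyC.
  have cop : coprimez p r`_k.
    by rewrite /coprimez /gcdz eqz_nat -/(coprime _ _) prime_coprime // -dvdzE.
  have [[u v] /= Euv] := coprimezP _ _ cop.
  (* A leading coefficient of [r] prime to [p] is turned into 1 by Bezout: [h = v r + p u X^k] is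
     monic with value in [M], of degree below that of [g]. *)
  pose h := v%:P * r1 + 'X^k.
  have szh : (size (v%:P * r1)%R < size ('X^k : {poly int}))%N.
    rewrite size_polyXn ltnS mul_polyC; exact: leq_trans (size_scale_leq _ _) szr1.
  have Eh : h = v%:P * r + (p%:Z)%:P * (u%:P * 'X^k).
    have E1 : 1 = u%:P * (p%:Z)%:P + v%:P * (r`_k)%:P :> {poly int}.
      by rewrite -!polyCM -polyCD Euv.
    by rewrite {1}Er /h -['X^k in LHS]mul1r E1; ring.
  suff /min_n : Q k.+1 by rewrite leqNgt -Ek ltr.
  apply/asboolP; exists h.
    by rewrite monicE /h addrC lead_coefDl // lead_coefXn.
  split; first by rewrite Eh rmorphD; apply: MD; [exact: Mev | exact: ideal_evzp].
  by rewrite /h addrC size_polyDl // size_polyXn.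
exists (Pdiv.Ring.rdivp q g), r.
by rewrite {1}(Pdiv.RingMonic.rdivp_eq mong q) mulrC Er mul_polyC.
Qed.

Lemma in_ideal_square_mem g q : M (evz x g) -> in_ideal_square p g q -> M (evz x q).
Proof.
move=> Mg [a [b [d ->]]]; rewrite !rmorphD; apply: MD; first apply: MD.
- by rewrite mulrC expr2 mulrA; apply: Mev.
- by rewrite mulrAC; apply: Mev.
- by rewrite expr2 -mulrA; apply: ideal_evzp.
Qed.

(** First [p] divides [c], since [c] is in [M]. Then [p] divides [g^2 a], hence [a] by Gauss, [g]
    being monic. After division by [p] the quotient [c'] is again in [M]. *)
Lemma const_in_ideal_square (g : {poly int}) (c : int) :
  g \is monic -> M (evz x g) -> in_ideal_square p g c%:P -> ((p ^ 2)%:Z %| c)%Z.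
Proof.
move=> mong Mg sqc; have [a [b [d E]]] := sqc.
have /dvdzP [c' Ec'] : (p%:Z %| c)%Z.
  by apply/Mp; rewrite -(evzC x); apply: in_ideal_square_mem sqc.
have : g ^+ 2 * a \is a polyOver (dvdz p).
  apply/polyOver_dvdzP; exists (c'%:P - g * b - (p%:Z)%:P * d).
  rewrite -mul_polyC.
  have -> : g ^+ 2 * a = c%:P - (p%:Z)%:P * g * b - (p%:Z)%:P ^+ 2 * d by rewrite E; ring.
  by rewrite Ec' polyCM; ring.
rewrite -dvdz_contents zcontentsM zcontents_monic ?monic_exp // mul1r dvdz_contents.
move=> /polyOver_dvdzP [a' Ea'].
have p0 : (p%:Z)%:P != 0 :> {poly int} by rewrite polyC_eq0 eqz_nat -lt0n prime_gt0.
have Ec : c'%:P = g ^+ 2 * a' + g * b + (p%:Z)%:P * d.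
  apply: (mulfI p0); rewrite -polyCM mulrC -Ec' E Ea' -mul_polyC; ring.
have /dvdzP [c2 Ec2] : (p%:Z %| c')%Z.
  apply/Mp; rewrite -(evzC x) Ec !rmorphD; apply: MD; first apply: MD.
  - by rewrite mulrC expr2 mulrA; apply: Mev.
  - by rewrite mulrC; apply: Mev.
  - exact: ideal_evzp.
by rewrite Ec' Ec2 -mulrA dvdz_mull // expnS expn1 PoszM dvdzz.
Qed.

(** Write [F = g h + p r], so that [g(x) h(x) = - p r(x)]. If [h(x)] is a local unit, [p] is a
    uniformizer; if [r(x)] is, [g(x)] is one. Otherwise [h] and [r] are in [(p, g)]. *)
Lemma dvr_or_in_ideal_square (g : {poly int}) :
  M (evz x g) -> (forall q, M (evz x q) -> exists s r, q = g * s + (p%:Z)%:P * r) ->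
  is_dvr (localization (Zadj x) M) \/ in_ideal_square p g F.
Proof.
move=> Mg genM.
have Az q : Zadj x (evz x q) by apply: Zadj_evz.
have dvr := dvr_of_principal (Zadj_subring x) maxM pr_p Mp (Zadj_integral monF Fx).
have [h [r EF]] : exists h r, F = g * h + (p%:Z)%:P * r.
  by apply: genM; rewrite Fx; apply: maxideal0 maxM.
have EFx : evz x g * evz x h = - (p%:R * evz x r).
  by apply/eqP; rewrite -addr_eq0 -Fx EF rmorphD !rmorphM /= evzC.
have MpR : M p%:R by apply/(Mp p%:Z); rewrite dvdzz.
have [Mh|nMh] := EM (M (evz x h)); last first.
  left; apply: (dvr p%:R) => // y My.
  have [q Eq] := maxidealW maxM My; rewrite -/(evz x q) in Eq.
  have [s [t Et]] : exists s t, q = g * s + (p%:Z)%:P * t by apply: genM; rewrite -Eq.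
  exists (evz x h), (evz x (t * h - r * s)); split=> //.
  rewrite Eq Et rmorphB rmorphD !rmorphM /= evzC mulrDl mulrAC EFx -[p%:~R]/(p%:R : R); ring.
have [Mr|nMr] := EM (M (evz x r)); last first.
  left; apply: (dvr (evz x g)) => // y My.
  have [q Eq] := maxidealW maxM My; rewrite -/(evz x q) in Eq.
  have [s [t Et]] : exists s t, q = g * s + (p%:Z)%:P * t by apply: genM; rewrite -Eq.
  exists (evz x r), (evz x (s * r - h * t)); split=> //.
  rewrite rmorphB !rmorphM /= mulrBr (mulrA _ (evz x h)) EFx Eq Et rmorphD.
  rewrite !rmorphM /= evzC -[p%:~R]/(p%:R : R); ring.
right; have [s [t Eh]] := genM _ Mh; have [s' [t' Er]] := genM _ Mr.
rewrite EF Eh Er; apply: in_ideal_squareD.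
  by have := in_ideal_squareM p g 1 1 0 s t; rewrite mulr1 mulr0 addr0 mul1r.
by have := in_ideal_squareM p g 1 0 1 s' t'; rewrite mulr1 mulr0 add0r mul1r.
Qed.

Lemma deriv_in_ideal g q : M (evz x g) -> in_ideal_square p g q -> M (evz x q^`()).
Proof.
move=> Mg [a [b [d ->]]].
have -> : (g ^+ 2 * a + (p%:Z)%:P * g * b + (p%:Z)%:P ^+ 2 * d)^`() =
    (2%:P * g^`() * a + g * a^`() + (p%:Z)%:P * b^`()) * g +
    (p%:Z)%:P * (g^`() * b + (p%:Z)%:P * d^`()).
  by rewrite !(derivE, expr2); ring.
by rewrite rmorphD; apply: MD; [exact: Mev | exact: ideal_evzp].
Qed.

(** The derivative is [2^n] times the product of the earlier iterates, and the prime ideal [M]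
    misses 2. *)
Lemma quad_iter_deriv_in_ideal (c : int) n : odd p ->
  M (evz x (quad_iter c n)^`()) -> exists2 k, (k < n)%N & M (evz x (quad_iter c k)).
Proof.
move=> oddp; have prM := maximal_prime (Zadj_subring x) maxM (Zadj_evz x _) (Zadj_evz x _).
elim: n => [|n IH] /=.
  by rewrite derivX rmorph1 => /(maximal_ideal1 maxM).
have -> : (quad_iter c n ^+ 2 - c%:P)^`() = 2%:P * (quad_iter c n * (quad_iter c n)^`()).
  by rewrite !(derivE, expr2); ring.
rewrite rmorphM => /prM [].
  rewrite evzC => /Mp; rewrite dvdzE => /(@dvdn_leq p 2 isT) le2.
  by have := prime_gt1 pr_p; move: oddp; case: (p) le2 => [|[|[|]]].
rewrite rmorphM => /prM [Mq|/IH [k ltk Mk]]; first by exists n.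
by exists k => //; apply: ltnW.
Qed.

End OverPrime.

Lemma quad_iter_not_in_ideal_square (R : realType) (x : R) (nu p : nat) (M : R -> Prop) n
    (g : {poly int}) :
    (nu %% 4 = 2 \/ nu %% 4 = 3)%N -> prime p ->
    (forall m, (0 < m)%N -> ~~ ((p ^ 2)%:Z %| (quad_iter nu m)`_0)%Z) ->
    is_maximal_ideal (Zadj x) M -> (forall m : int, M m%:~R <-> (p%:Z %| m)%Z) ->
    g \is monic -> M (evz x g) ->
    (forall q, M (evz x q) -> exists s r, q = g * s + (p%:Z)%:P * r) ->
    (0 < n)%N ->
  ~ in_ideal_square p g (quad_iter nu n).
Proof.
move=> nu4 pr_p sqf maxM Mp mong Mg genM n0 sqF.
(* Used for both parities of [p]: since [w] is in [(p, g)], the term [u w^2] is in its square, which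
   leaves the constant there. *)
have sqc (u w : {poly int}) (c : int) : in_ideal_square p g (u * w ^+ 2 + c%:P) ->
    M (evz x w) -> ((p ^ 2)%:Z %| c)%Z.
  move=> sqw /genM [s [r Ew]].
  apply: (const_in_ideal_square pr_p maxM Mp mong Mg).
  have -> : c%:P = (u * w ^+ 2 + c%:P) + - u * w * w by ring.
  by apply: in_ideal_squareD => //; rewrite Ew; apply: in_ideal_squareM.
have [oddp|evenp] := boolP (odd p).
  have [k ltk Mk] := quad_iter_deriv_in_ideal pr_p maxM Mp oddp (deriv_in_ideal maxM Mp Mg sqF).
  case: n n0 ltk sqF => // n _ ltk.
  rewrite -(subnK (ltnW ltk)) quad_iterD subSn //.
  have [H ->] := quad_iterS_even nu (n - k).
  rewrite comp_polyD comp_polyM comp_polyC comp_Xn_poly => /sqc/(_ Mk).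
  exact/negP/sqf.
have p2 : p = 2%N by move: pr_p => /even_prime []; rewrite // (negPf evenp).
case: n n0 sqF => // n _ /= sqF.
have prM := maximal_prime (Zadj_subring x) maxM (Zadj_evz x _) (Zadj_evz x _).
have Mq := in_ideal_square_mem maxM Mp Mg sqF.
(* [a] is the parity of [nu], so [(q - a)^2] and [q^2 - nu] agree modulo 2 and [q - a] takes a value
   in [M]. *)
have [a [d [Ea Enu]]] : exists a d : int, a ^+ 2 = a /\ nu%:Z = 4 * d + 2 + a.
  by case: nu4 => nu4; [exists 0 | exists 1]; exists (Posz (nu %/ 4)); split=> //; lia.
set q := quad_iter nu n in sqF Mq.
have EaP : a%:P ^+ 2 = a%:P :> {poly int} by rewrite -rmorphXn Ea.
have EnuP : nu%:Z%:P = 2%:P * (2%:P * d%:P + 1) + a%:P :> {poly int}.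
  by rewrite Enu !polyCD polyCM; ring.
have Esq : (q - a%:P) * (q - a%:P) = q ^+ 2 - 2%:P * a%:P * q + a%:P.
  by rewrite -[X in _ = _ + X]EaP; ring.
have Mw : M (evz x (q - a%:P)).
  suff : M (evz x ((q - a%:P) * (q - a%:P))) by rewrite rmorphM => /prM [].
  have -> : (q - a%:P) * (q - a%:P) = (q ^+ 2 - nu%:Z%:P) +
      (p%:Z)%:P * (2%:P * d%:P + 1 + a%:P - a%:P * q).
    by rewrite Esq EnuP p2; ring.
  by rewrite rmorphD; apply: (maxidealD maxM) => //; apply: ideal_evzp maxM Mp _.
have [s [r Ew]] := genM _ Mw.
(* This differs from [q^2 - nu] by [-2 a (q - a)], where both 2 and [q - a] are in [(p, g)]. Then
   [sqc] would make 4 divide [4 d + 2]. *)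
have sqw : in_ideal_square p g (1 * (q - a%:P) ^+ 2 + (- (4 * d + 2))%:P).
  have -> : 1 * (q - a%:P) ^+ 2 + (- (4 * d + 2))%:P =
      (q ^+ 2 - nu%:Z%:P) + - a%:P * (g * 0 + (p%:Z)%:P * 1) * (q - a%:P).
    have E2 : - a%:P * (g * 0 + (p%:Z)%:P * 1) * (q - a%:P) = 2%:P * (a%:P - a%:P * q).
      by rewrite -[X in _ = _ * (X - _)]EaP p2; ring.
    by rewrite E2 mul1r expr2 Esq EnuP polyCN (polyCD (4 * d)) polyCM; ring.
  by apply: in_ideal_squareD => //; rewrite Ew; apply: in_ideal_squareM.
have := sqc _ _ _ sqw Mw; rewrite p2; clear; lia.
Qed.

(** * The ideal (p, x) *)

(** The ideal [(p, x)] of Z[x]. *)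
Definition evaluation_ideal (R : realType) (x : R) (p : nat) (y : R) : Prop :=
  exists2 q, y = evz x q & (p%:Z %| q`_0)%Z.

(** Two polynomials with the same value at [x] differ by a multiple of [F], whose constant term is
    divisible by [p]. So the constant term modulo [p] depends only on the value, and the quotient is
    the field with [p] elements. *)
Lemma evaluation_ideal_maximal (R : realType) (x : R) (F : {poly int}) (p : nat) :
    prime p -> F \is monic -> irreducible_poly (map_poly intr F : {poly rat}) ->
    evz x F = 0 -> (p%:Z %| F`_0)%Z ->
  let M := evaluation_ideal x p in
  [/\ forall q, M (evz x q) -> (p%:Z %| q`_0)%Z, is_maximal_ideal (Zadj x) M &
      forall m : int, M m%:~R <-> (p%:Z %| m)%Z].
Proof.
move=> pr_p monF irF Fx pF M.
have Mev q : M (evz x q) -> (p%:Z %| q`_0)%Z.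
  move=> [r Er pr].
  have [h Eh] : exists h, q - r = F * h.
    by apply: (minpoly_dvd monF irF Fx); rewrite rmorphB /= Er subrr.
  by rewrite -(subrK r q) coefD rpredD // Eh coef0M dvdz_mulr.
have Mm (m : int) : M m%:~R <-> (p%:Z %| m)%Z.
  split=> [|pm]; first by rewrite -(evzC x) => /Mev; rewrite coefC.
  by exists m%:P; rewrite ?evzC ?coefC.
split=> //; split; [|split].
- split; [|split; [|split]].
  + by move=> _ [q -> _]; apply: Zadj_evz.
  + by exists 0; rewrite ?rmorph0 ?coef0.
  + move=> _ _ [q -> pq] [r -> pr]; exists (q - r); first by rewrite rmorphB.
    by rewrite coefB rpredB.
  + move=> _ _ [q ->] [r -> pr]; exists (q * r); first by rewrite rmorphM.
    by rewrite coef0M dvdz_mull.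
- exists 1; split; first by exists 1; rewrite rmorph1 hornerC.
  move=> /(Mm 1); rewrite dvdz1 => /eqP p1; move: pr_p; by rewrite (_ : p = 1%N).
move=> J [JA [J0 [JB JM]]] MJ.
have [JsubM|nJM] := EM (forall y, J y -> M y).
  by left=> y; split; [exact: JsubM | exact: MJ].
right=> y Ay.
have [z [Jz nMz]] : exists z, J z /\ ~ M z.
  apply: contra_notP nJM => nJM z Jz; apply: contra_notP nJM => nMz.
  by exists z.
have [q Eq] := JA z Jz; rewrite -/(evz x q) in Eq.
have npq : ~~ (p%:Z %| q`_0)%Z by apply: contra_notN nMz => pq; exists q.
have cop : coprimez p q`_0.
  by rewrite /coprimez /gcdz eqz_nat -/(coprime _ _) prime_coprime // -dvdzE.
have [[u v] /= Euv] := coprimezP _ _ cop.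
have J1 : J 1.
  have -> : 1 = evz x (v%:P) * z - evz x (v%:P * q - 1).
    by rewrite Eq rmorphB rmorphM rmorph1 /=; ring.
  apply: JB; first by apply: JM => //; apply: Zadj_evz.
  apply: MJ; exists (v%:P * q - 1) => //.
  rewrite coefB coefCM coefC /= -Euv opprD addrCA subrr addr0 rpredN.
  exact: dvdz_mull.
by rewrite -[y]mulr1; apply: JM.
Qed.

Lemma evaluation_ideal_not_dvr (R : realType) (x : R) (F H : {poly int}) (p : nat) (c : int) :
    prime p -> F \is monic -> irreducible_poly (map_poly intr F : {poly rat}) ->
    evz x F = 0 -> x != 0 -> F = H * 'X^2 + ((p%:Z) ^+ 2 * c)%:P ->
  ~ is_dvr (localization (Zadj x) (evaluation_ideal x p)).
Proof.
move=> pr_p monF irF Fx x0 EF.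
have EF0 : F`_0 = p%:Z ^+ 2 * c.
  by rewrite EF coefD coefMXn /= coefC add0r.
have [] := evaluation_ideal_maximal pr_p monF irF Fx.
  by rewrite EF0 expr2 -mulrA dvdz_mulr.
set M := evaluation_ideal x p; move=> Mev maxM Mm [v [vM [_ [_ vS]]]].
have p0 : p%:R != 0 :> R by rewrite pnatr_eq0 -lt0n prime_gt0.
have SA q : localization (Zadj x) M (evz x q).
  exists (evz x q), 1; split; first exact: Zadj_evz.
  split; first exact: (subring1 (Zadj_subring x)).
  by split; [exact: maximal_ideal1 maxM | rewrite divr1].
have frac q r : evz x r != 0 -> frac_field (localization (Zadj x) M) (evz x q / evz x r).
  by move=> r0; exists (evz x q), (evz x r).
(* A quotient of nonnegative valuation is a fraction [t / s] with [s] outside the ideal; clearing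
   denominators lifts this to an identity modulo [F] in Z[X]. *)
have ratio_in q r : evz x q != 0 -> evz x r != 0 -> v (evz x r) <= v (evz x q) ->
    exists s t h : {poly int}, ~~ (p%:Z %| s`_0)%Z /\ q * s - r * t = F * h.
  move=> q0 r0 le_rq.
  have fr : frac_field (localization (Zadj x) M) (evz x r).
    by rewrite -[evz x r]divr1 -(rmorph1 (evz x)); apply: frac; rewrite rmorph1 oner_eq0.
  have qr0 : evz x q / evz x r != 0 by rewrite mulf_neq0 ?invr_eq0.
  have : localization (Zadj x) M (evz x q / evz x r).
    apply/vS; right; split; [exact: frac | split=> //].
    have := vM _ _ (frac q r r0) fr qr0 r0; rewrite divfK // => Ev.
    by move: le_rq; rewrite Ev lerDr.
  move=> [_ [_ [[t ->] [[s ->] [nMs]]]]]; rewrite -!/(evz x _) in nMs *.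
  move=> E; exists s, t.
  have s0 : evz x s != 0 by apply: notin_ideal_neq0 nMs; exact: maxM.
  have [h Eh] : exists h, q * s - r * t = F * h.
    apply: (minpoly_dvd monF irF Fx); rewrite rmorphB !rmorphM /=.
    have -> : evz x q = evz x q / evz x r * evz x r by rewrite divfK.
    by rewrite E; field.
  by exists h; split=> //; apply/negP => ps; apply: nMs; exists s.
have evp : evz x (p%:Z)%:P != 0 by rewrite evzC.
have evX : evz x 'X != 0 by rewrite evzX.
have pP0 : (p%:Z)%:P != 0 :> {poly int} by rewrite polyC_eq0 eqz_nat -lt0n prime_gt0.
have EF' : F = H * 'X^2 + (p%:Z)%:P ^+ 2 * c%:P by rewrite {1}EF polyCM rmorphXn.
(* If [p / x] is in the localization, comparing constant coefficients gives [p | s(0)]; if [x / p]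
   is, the coefficients of [X] do. Both contradict the choice of [s]. *)
case: (leP (v (evz x 'X)) (v (evz x (p%:Z)%:P))) => [le|/ltW le].
  have [s [t [h [/negP nps E]]]] := ratio_in _ _ evp evX le; apply: nps.
  have {}E : (p%:Z)%:P * (s - (p%:Z)%:P * c%:P * h) = (t + 'X * H * h) * 'X.
    by apply/eqP; rewrite -subr_eq0 -[X in _ == X](subrr (F * h)) -{1}E EF'; apply/eqP; ring.
  have /eqP := congr1 (fun u : {poly int} => u`_0) E.
  rewrite coefCM coefMX /= mulf_eq0 eqz_nat -leqn0 leqNgt prime_gt0 //= coefB subr_eq0.
  by move=> /eqP ->; rewrite -mulrA coefCM dvdz_mulr.
have [s [t [h [/negP nps E]]]] := ratio_in _ _ evX evp le; apply: nps.
have {}E : 'X * (s - 'X * H * h) = (p%:Z)%:P * (t + (p%:Z)%:P * c%:P * h).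
  by apply/eqP; rewrite -subr_eq0 -[X in _ == X](subrr (F * h)) -{1}E EF'; apply/eqP; ring.
have := congr1 (fun u : {poly int} => u`_1) E.
rewrite coefXM coefCM /= coefB -mulrA coefXM /= subr0 => ->.
exact: dvdz_mulr.
Qed.

Theorem theorem1p6 (R : realType) (nu p : nat) (P : nat -> {poly int}) :
  (3 <= nu)%N ->
  (forall q : nat, prime q -> ~~ (q ^ 2 %| nu)%N) ->
  (nu %% 4 = 2 \/ nu %% 4 = 3)%N ->
  (* P n is the minimal polynomial of x_n over Q (monic, integer coefficients) *)
  (forall n, P n \is monic /\
             root (map_poly intr (P n) : {poly R}) (xseq (nu%:R : R) n) /\
             irreducible_poly (map_poly intr (P n) : {poly rat})) ->
  prime p ->
  (exists n, (0 < n)%N /\ (p%:Z %| (P n)`_0)%Z) ->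
  forall np : nat,
    (0 < np)%N -> (p%:Z %| (P np)`_0)%Z ->
    (forall m, (0 < m < np)%N -> ~~ (p%:Z %| (P m)`_0)%Z) ->
  (~~ ((p ^ 2)%:Z %| (P np)`_0)%Z ->
     forall n, (0 < n)%N ->
     forall M : R -> Prop,
       is_maximal_ideal (Zadj (xseq (nu%:R : R) n)) M ->
       (forall m : int, M (m%:~R) <-> (p%:Z %| m)%Z) ->
       is_dvr (localization (Zadj (xseq (nu%:R : R) n)) M))
  /\
  ((forall M : R -> Prop,
       is_maximal_ideal (Zadj (xseq (nu%:R : R) np)) M ->
       (forall m : int, M (m%:~R) <-> (p%:Z %| m)%Z) ->
       is_dvr (localization (Zadj (xseq (nu%:R : R) np)) M)) ->
   ~~ ((p ^ 2)%:Z %| (P np)`_0)%Z).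
Proof.
move=> nu3 _ nu4 minP pr_p _ np np0 pnp minp.
have ev0 n : evz (xseq (nu%:R : R) n) (quad_iter nu n) = 0.
  by have := quad_iter_xseq R nu n 0; rewrite addn0.
have mon n : quad_iter nu n \is monic by case: (quad_iter_monic_size nu n).
have irr n := quad_iter_irreducible n nu4.
have EP n : P n = quad_iter nu n.
  have [monP [/eqP rP irP]] := minP n.
  exact: (minpoly_unique monP irP rP (mon n) (irr n) (ev0 n)).
rewrite !EP in pnp *; have {}minp m : (0 < m < np)%N -> ~~ (p%:Z %| (quad_iter nu m)`_0)%Z.
  by move/minp; rewrite EP.
split=> [p2np n n0 M maxM Mp | dvr].
  have sqf := quad_iter_const_sqfree np0 pnp minp p2np.
  have [g [mong Mg genM]] := maximal_ideal_generators (mon n) (ev0 n) pr_p maxM Mp.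
  have [//|sqF] := dvr_or_in_ideal_square (mon n) (ev0 n) pr_p maxM Mp Mg genM.
  by case: (quad_iter_not_in_ideal_square nu4 pr_p sqf maxM Mp mong Mg genM n0 sqF).
have [_ maxM Mp] := evaluation_ideal_maximal pr_p (mon np) (irr np) (ev0 np) pnp.
apply/negP => /dvdzP [c Ec].
(* A positive index is what gives the shape [H X^2 + p^2 c] and a nonzero radical. *)
case: np np0 {pnp minp} Ec dvr maxM Mp => // n _ Ec dvr maxM Mp.
have [H EH] := quad_iterS_even nu n.
apply: (evaluation_ideal_not_dvr (H := H) (c := c) pr_p (mon n.+1) (irr n.+1) (ev0 n.+1));
  last exact: dvr.
  rewrite gt_eqF //= sqrtr_gt0 ltr_wpDl ?xseq_ge0 // ltr0n.
  by apply: leq_trans nu3.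
by rewrite {1}EH Ec [in LHS](mulrC c) expnS expn1 PoszM expr2.
Qed.
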